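(* Let $n\geq 2$ be an integer. There are sequences of complex numbers $\{\eta_j\}_{j=0}^\infty$ such that $$M_m(\{\eta_j\})=\sum_{j=0}^\infty \eta_j^m=0\quad\text{for all integers } m\geq 1 \text{ with } n\nmid m,$$ whose non-zero terms are not a rearrangement of a symmetrical sequence of order $n$.
   Context: Let $\omega_n=e^{2\pi i/n}$. A sequence of complex numbers $\{z_j\}$ is symmetrical of order $n$ if, for all $0\leq k\leq n-1$, $\{z_j\}=\{z_j\omega_n^k\}$ as sets with repetitions (multisets); the same definition is used for finite sequences. Series are sums in the ordinary sense (limits of partial sums in the given order), possibly only conditionally convergent. *)

(* Defs.v *)
From HB Require Import structures.
From mathcomp Require Import all_boot all_order all_algebra.
From mathcomp Require Import complex.
From mathcomp Require Import all_classical all_reals all_analysis.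

Set Implicit Arguments.
Unset Strict Implicit.
Unset Printing Implicit Defensive.

Import Order.TTheory GRing.Theory Num.Theory.
Import numFieldNormedType.Exports.

Local Open Scope classical_set_scope.
Local Open Scope ring_scope.
Local Open Scope complex_scope.

(* The complex numbers are R[i] for R : realType. The libraries have no complex
   exponential, so e^{ix} is given by Euler's formula. *)
Definition expi (R : realType) (x : R) : R[i] := cos x +i* sin x.

Definition omega (R : realType) (n : nat) : R[i] := expi (2 * pi / n%:R).

(* A sequence, finite or infinite, is a family f : I -> T; the index type is nat,
   an ordinal type, or the set of positions of the terms that are kept. Two
   families have the same multiset of values iff each is a rearrangement of the
   other through a bijection between the index types. *)
Definition rearrangement (I J T : Type) (f : I -> T) (g : J -> T) : Prop :=
  exists s : I -> J, bijective s /\ forall i, f i = g (s i).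

Definition symmetrical (R : realType) (I : Type) (n : nat) (z : I -> R[i]) :
    Prop :=
  forall k, (k < n)%N -> rearrangement z (fun i => z i * omega R n ^+ k).

Definition nonzero_terms (R : realType) (z : nat -> R[i]) :
    {j : nat | z j != 0} -> R[i] :=
  fun j => z (val j).
Arguments nonzero_terms {R} z _.

(* M_m(z) = s, as the limit of the partial sums. The topology of R[i]^o is the one
   given by the modulus; R[i] itself carries no topology in the library. *)
Definition power_sum_eq (R : realType) (m : nat) (z : nat -> R[i]) (s : R[i]) :
    Prop :=
  series (fun j => z j ^+ m : R[i]^o) @ \oo --> (s : R[i]^o).

(* Main.v *)
Require Import Defs.
From HB Require Import structures.
From mathcomp Require Import all_boot all_order all_algebra.
From mathcomp Require Import complex lra.
From mathcomp Require Import all_classical all_reals all_analysis.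

Import Order.TTheory GRing.Theory Num.Theory.
Import numFieldNormedType.Exports.

Local Open Scope classical_set_scope.
Local Open Scope ring_scope.
Local Open Scope complex_scope.

(** The sequence built here starts with [eta 0 = 1], all its later terms have
    modulus less than 1, and all its power sums vanish, even those of exponent
    divisible by [n] ([exists_vanishing_power_sums]). It cannot be symmetrical
    of order [n >= 2]: rotating the term 1 would give another term of modulus 1
    ([not_symmetrical_rearrangement]).

    Everything after the first term comes in finite blocks, the block [k]
    repairing the power sum of exponent [K = k + 1]. It consists of many copies
    of the scaled roots of unity [a * w ^ i], [i < K], with [w] of order [K].
    Such a list has zero power sum for every exponent that [K] does not divide,
    so the exponents [0 < m < K], which earlier blocks have already repaired,
    stay repaired; at the exponent [K] itself, [N] copies contribute
    [N * K * a ^ K], and this can be given any prescribed value. Taking [N]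
    large makes [a] as small as desired. This matters for convergence: inside
    a block the partial sum of exponent [m < K] returns to 0 after each copy,
    so it never exceeds [K * |a|], which is chosen to tend to 0 as [k] grows
    ([correction_block]). Higher power sums are disturbed by a block, but each
    of them is repaired when its turn comes. *)

(** * Roots of unity *)

Lemma expi0 (R : realType) : expi (0 : R) = 1.
Proof. by rewrite /expi cos0 sin0. Qed.

Lemma expiD (R : realType) (x y : R) : expi (x + y) = expi x * expi y.
Proof. by rewrite /expi cosD sinD; simpc; congr (_ +i* _); rewrite addrC. Qed.

Lemma expiMn (R : realType) (x : R) (m : nat) : expi (x *+ m) = expi x ^+ m.
Proof. by elim: m => [|m IHm]; rewrite ?expi0 // mulrS exprS expiD IHm. Qed.

(** By the duplication formula [cos x = 1 - 2 sin^2 (x / 2)], and the sine is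
    positive on [(0, pi)]. *)
Lemma expi_neq1 (R : realType) (x : R) : 0 < x < 2 * pi -> expi x != 1.
Proof.
move=> /andP[x_gt0 x_lt]; apply/eqP => -[+ _].
have -> : x = (x / 2) *+ 2 by rewrite -mulr_natr divfK // pnatr_eq0.
rewrite cos_mulr2n cos2sin2 => cosx1.
have : sin (x / 2) ^+ 2 = 0 by lra.
apply/eqP; rewrite expf_eq0 /= gt_eqF // sin_gt0_pi //.
by rewrite divr_gt0 //= ltr_pdivrMr // mulrC.
Qed.

Lemma omega_primitive (R : realType) (n : nat) :
  (0 < n)%N -> n.-primitive_root (omega R n).
Proof.
move=> n_gt0; have n0 : 0 < n%:R :> R by rewrite ltr0n.
rewrite /primitive_root_of_unity n_gt0 /=; apply/forallP => i.
rewrite unity_rootE -expiMn; apply/eqP; have [in_eq|in_neq] := eqVneq i.+1 n.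
  apply/eqP; rewrite in_eq -[_ *+ n]mulr_natr divfK ?gt_eqF //.
  rewrite mulr_natl expiMn /expi cospi sinpi.
  by rewrite expr2; simpc.
apply/negbTE/expi_neq1.
have i_lt : (i.+1 < n)%N by rewrite ltn_neqAle in_neq ltn_ord.
rewrite -[_ *+ i.+1]mulr_natr mulr_gt0 ?divr_gt0 ?mulr_gt0 ?pi_gt0 //=.
by rewrite mulrAC ltr_pdivrMr // ltr_pM2l ?mulr_gt0 ?pi_gt0 // ltr_nat.
Qed.

Lemma norm_omega (R : realType) (n : nat) : `|omega R n| = 1.
Proof. by rewrite /omega /expi normc_def /= cos2Dsin2 sqrtr1. Qed.

(** The sum is geometric with ratio [w ^+ m], which differs from 1. *)
Lemma sum_prim_root_expr (C : fieldType) (n m : nat) (w : C) :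
  n.-primitive_root w -> ~~ (n %| m)%N -> \sum_(i < n) (w ^+ i) ^+ m = 0.
Proof.
move=> w_prim ndvd.
have wm1 : w ^+ m - 1 != 0.
  by rewrite subr_eq0 -(expr0 w) (eq_prim_root_expr w_prim) mod0n.
apply: (mulfI wm1); rewrite mulr0.
under eq_bigr do rewrite exprAC.
by rewrite -subrX1 exprAC (prim_expr_order w_prim) expr1n subrr.
Qed.

(** * Blocks that correct one power sum *)

Section Block.
Variables (R : realType) (K : nat).
Hypothesis K_gt0 : (0 < K)%N.

Lemma scaled_roots_of_unity (a : R[i]) :
  exists W : seq R[i],
    [/\ size W = K,
        {in W, forall x, `|x| = `|a|},
        forall m, (0 < m < K)%N -> \sum_(x <- W) x ^+ m = 0 &
        \sum_(x <- W) x ^+ K = a ^+ K *+ K].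
Proof.
pose w := omega R K; have w_prim := omega_primitive R K K_gt0.
have sumE m : \sum_(x <- mkseq (fun i => a * w ^+ i) K) x ^+ m
    = a ^+ m * \sum_(i < K) (w ^+ i) ^+ m.
  rewrite big_map -{1}(subn0 K) big_mkord mulr_sumr.
  by apply: eq_bigr => i _; rewrite exprMn.
exists (mkseq (fun i => a * w ^+ i) K); split.
- by rewrite size_mkseq.
- move=> _ /mapP[i _ ->]; rewrite normrM normrX.
  by rewrite norm_omega expr1n mulr1.
- move=> m /andP[m_gt0 m_lt]; rewrite sumE (sum_prim_root_expr _ _ _ _ w_prim).
    by rewrite mulr0.
  by apply/negP => /(dvdn_leq m_gt0); rewrite leqNgt m_lt.
rewrite sumE; under eq_bigr do rewrite exprAC (prim_expr_order w_prim) expr1n.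
by rewrite sumr_const card_ord mulr_natr.
Qed.

(** The length of the block does not enter the bound on partial sums: each full
    copy of the scaled roots contributes 0, so only the unfinished last copy
    counts, and it has at most [K] terms of modulus [|a| ^ m <= |a|]. *)
Lemma repeated_scaled_roots (a e : R[i]) (N : nat) :
    `|a| * K%:R <= e -> e <= 1 ->
  exists B : seq R[i],
    [/\ size B = (N * K)%N,
        {in B, forall x, `|x| <= e},
        forall m, (0 < m < K)%N -> \sum_(x <- B) x ^+ m = 0,
        \sum_(x <- B) x ^+ K = a ^+ K *+ (N * K) &
        forall r m, (0 < m < K)%N -> `|\sum_(x <- take r B) x ^+ m| <= e].
Proof.
move=> aKe e1.
have [W [szW normW sumW sumWK]] := scaled_roots_of_unity a.
have e_ge0 : 0 <= e by rewrite (le_trans _ aKe) // mulr_ge0.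
have ae : `|a| <= e by rewrite (le_trans _ aKe) // ler_peMr // ler1n.
elim: N => [|N [B [szB normB sumB sumBK takeB]]].
  by exists [::]; split=> [|x|m _||r m _]; rewrite ?big_nil ?normr0.
exists (W ++ B); split.
- by rewrite size_cat szW szB mulSn.
- by move=> x; rewrite mem_cat => /orP[/normW->|/normB].
- by move=> m mK; rewrite big_cat/= sumW // sumB // addr0.
- by rewrite big_cat/= sumWK sumBK -mulrnDr mulSn.
move=> r m mK; rewrite take_cat; case: ltnP => r_sz; last first.
  by rewrite big_cat/= sumW // add0r takeB.
rewrite (le_trans (ler_norm_sum _ _ _)) // (le_trans _ aKe) //.
have -> : `|a| * K%:R = \sum_(x <- W) `|a|.
  by rewrite big_const_seq count_predT szW iter_addr_0 mulr_natr.
rewrite -[in leRHS](cat_take_drop r W) big_cat/= -[leLHS]addr0.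
rewrite lerD ?sumr_ge0 // big_seq [leRHS]big_seq; apply: ler_sum => x xW.
rewrite normrX (normW _ (mem_take xW)).
by rewrite ler_iXnr //; [case/andP: mK|rewrite (le_trans ae)].
Qed.

End Block.

Lemma complex_nat_bound (R : realType) (z : R[i]) : exists N : nat, `|z| <= N%:R.
Proof.
exists (Num.truncn (Num.sqrt (complex.Re z ^+ 2 + complex.Im z ^+ 2))).+1.
by rewrite normc_def -(rmorph_nat (real_complex R)) lecR ltW // truncnS_gt.
Qed.

(** The equation [a ^+ K * (N * K) = c] has a solution for every [N > 0], and its
    modulus tends to 0 as [N] grows. *)
Lemma correction_block (R : realType) (K : nat) (c e : R[i]) :
    (0 < K)%N -> 0 < e -> e <= 1 ->
  exists B : seq R[i],
    [/\ (0 < size B)%N,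
        {in B, forall x, `|x| <= e},
        forall m, (0 < m < K)%N -> \sum_(x <- B) x ^+ m = 0,
        \sum_(x <- B) x ^+ K = c &
        forall r m, (0 < m < K)%N -> `|\sum_(x <- take r B) x ^+ m| <= e].
Proof.
move=> K_gt0 e_gt0 e_le1.
have d_gt0 : 0 < e / K%:R by rewrite divr_gt0 ?ltr0n.
have [N leN] := complex_nat_bound R (`|c| / (e / K%:R) ^+ K).
rewrite ger0_norm ?divr_ge0 ?exprn_ge0 ?(ltW d_gt0) // in leN.
pose a := K.-root (c / (N.+1 * K)%:R).
have aK : a ^+ K = c / (N.+1 * K)%:R by rewrite rootCK.
have aKe : `|a| * K%:R <= e.
  rewrite -ler_pdivlMr ?ltr0n // -(ler_pXn2r K_gt0) ?nnegrE ?(ltW d_gt0) //.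
  rewrite -normrX aK normrM normfV normr_nat ler_pdivrMr ?ltr0n ?muln_gt0 //.
  rewrite mulrC -ler_pdivrMr ?exprn_gt0 // (le_trans leN) // ler_nat.
  by rewrite (leq_trans (leqnSn N)) // leq_pmulr.
have [B [szB normB sumB sumBK takeB]] :=
  repeated_scaled_roots _ _ K_gt0 _ _ N.+1 aKe e_le1.
exists B; split=> //; first by rewrite szB muln_gt0.
rewrite sumBK aK -mulr_natr divfK //.
by rewrite pnatr_eq0 -lt0n muln_gt0.
Qed.

(** * Infinite concatenation of finite lists *)

Section Prefixes.
Variables (T : Type) (x0 : T) (P B : nat -> seq T).
Hypothesis PS : forall k, P k.+1 = P k ++ B k.
Hypothesis B_gt0 : forall k, (0 < size (B k))%N.

(** The prefix [P j.+1] already has more than [j] entries, so [x0] is never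
    reached. *)
Definition limit_seq (j : nat) : T := nth x0 (P j.+1) j.

Lemma leq_size_prefix k : (k <= size (P k))%N.
Proof.
elim: k => // k IHk; rewrite PS size_cat -addn1.
exact: leq_add IHk (B_gt0 k).
Qed.

Lemma prefix_cat k l : (k <= l)%N -> exists s, P l = P k ++ s.
Proof.
move=> /subnK <-; elim: (l - k)%N => [|d [s IHd]].
  by exists [::]; rewrite cats0.
by exists (s ++ B (d + k)%N); rewrite addSn PS IHd catA.
Qed.

Lemma nth_prefix k j : (j < size (P k))%N -> nth x0 (P k) j = limit_seq j.
Proof.
move=> j_lt; rewrite /limit_seq; have [/prefix_cat[s ->]|] := leqP k j.+1.
  by rewrite nth_cat j_lt.
move=> /ltnW/prefix_cat[s ->].
by rewrite nth_cat (leq_trans (ltnSn j) (leq_size_prefix _)).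
Qed.

Lemma mkseq_limit_seq k N : (N <= size (P k))%N ->
  mkseq limit_seq N = take N (P k).
Proof.
move=> leN; apply: (@eq_from_nth _ x0); rewrite size_mkseq ?size_takel // => j jN.
by rewrite nth_mkseq // nth_take // nth_prefix // (leq_trans jN).
Qed.

Lemma prefix_locate k0 N : (size (P k0) <= N)%N ->
  exists k, [/\ (k0 <= k)%N, (size (P k) <= N)%N & (N <= size (P k.+1))%N].
Proof.
move=> leN.
have bound k : (size (P k) <= N)%N -> (k <= N)%N.
  exact: leq_trans (leq_size_prefix k).
case: (ex_maxnP (ex_intro _ k0 leN) bound) => k kN kmax.
exists k; split=> //; first exact: kmax.
by apply/ltnW; rewrite ltnNge; apply/negP => /kmax; rewrite ltnn.
Qed.

End Prefixes.

(** * The sequence *)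

Lemma exists_vanishing_power_sums (R : realType) :
  exists eta : nat -> R[i],
    [/\ eta 0%N = 1, forall j, (0 < j)%N -> `|eta j| < 1 &
        forall m, (0 < m)%N -> power_sum_eq m eta 0].
Proof.
(* The bound on the block [k] must be less than 1 and tend to 0. *)
pose e k : R[i] := k.+2%:R^-1.
have e_gt0 k : 0 < e k by rewrite invr_gt0 ltr0n.
have e_lt1 k : e k < 1 by rewrite invf_lt1 ?ltr0n // ltr1n.
have [D DP] := choice (fun kc : nat * R[i] =>
  correction_block R kc.1.+1 kc.2 (e kc.1) (ltn0Sn _) (e_gt0 _) (ltW (e_lt1 _))).
(* The block [k] is chosen so as to cancel the power sum of exponent [k.+1] of
   everything before it. *)
pose fix P k := if k is k'.+1 then
  P k' ++ D (k', - \sum_(x <- P k') x ^+ k'.+1) else [:: 1].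
pose B k := D (k, - \sum_(x <- P k) x ^+ k.+1).
have PS k : P k.+1 = P k ++ B k by [].
have B_gt0 k : (0 < size (B k))%N by case: (DP (k, - \sum_(x <- P k) x ^+ k.+1)).
have Psum k m : (0 < m <= k)%N -> \sum_(x <- P k) x ^+ m = 0.
  elim: k => [|k IHk]; first by case: m.
  have [_ _ sumB sumBK _] := DP (k, - \sum_(x <- P k) x ^+ k.+1).
  rewrite PS big_cat /= => /andP[m_gt0]; rewrite leq_eqVlt => /predU1P[->|m_lt].
    by rewrite sumBK subrr.
  by rewrite sumB ?IHk ?m_gt0 ?add0r.
have Pnorm k : exists2 s, P k = 1 :: s & {in s, forall x, `|x| < 1}.
  elim: k => [|k [s Ps s1]]; first by exists [::].
  exists (s ++ B k); first by rewrite PS Ps.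
  move=> x; rewrite mem_cat => /orP[/s1 //|xB].
  have [_ /(_ x xB) /= xe _ _ _] := DP (k, - \sum_(x <- P k) x ^+ k.+1).
  exact: le_lt_trans xe (e_lt1 k).
pose eta := limit_seq _ 0 P.
exists eta; split=> [//|j j_gt0|m m_gt0].
  rewrite /eta /limit_seq; have := leq_size_prefix _ _ _ PS B_gt0 j.+1.
  have [s -> s1] := Pnorm j.+1; case: j j_gt0 => // j _ /= sz.
  by apply: s1; rewrite mem_nth.
apply/cvgr0Pnorm_le => eps eps_gt0.
have [N0 leN0] := complex_nat_bound R eps^-1.
(* From the block [k0] on, the power sum of exponent [m] has been repaired and
   the blocks deviate from it by at most [eps]. *)
pose k0 := maxn m N0.
exists (size (P k0)) => // N /= leN.
have [k [k0k leNk ltNk]] := prefix_locate _ _ _ PS B_gt0 _ _ leN.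
have mk : (m <= k)%N by rewrite (leq_trans (leq_maxl m N0)).
have -> : series (fun j => eta j ^+ m : R[i]^o) N = \sum_(x <- mkseq eta N) x ^+ m.
  by rewrite /series /= big_map /index_iota subn0.
rewrite (mkseq_limit_seq _ _ _ _ PS B_gt0 _ _ ltNk) PS take_cat ltnNge leNk /=.
rewrite big_cat /= Psum ?m_gt0 // add0r.
have [_ _ _ _ takeB] := DP (k, - \sum_(x <- P k) x ^+ k.+1).
apply: (le_trans (takeB _ _ _)); first by rewrite m_gt0.
rewrite /= /e invf_ple ?posrE ?ltr0n //.
rewrite (le_trans (real_ler_norm _)) ?(le_trans leN0) ?ger0_real ?invr_ge0 ?ltW //.
rewrite ltr_nat.
by rewrite !ltnS (leq_trans _ (leq_trans k0k (leqnSn k))) // leq_maxr.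
Qed.

(** Symmetry under rotation by [omega], applied to the term 1, yields a term
    [eta j] with [eta j * omega = 1], hence of modulus 1. Only [j = 0] is left,
    and it would give [omega = 1]. *)
Lemma not_symmetrical_rearrangement (R : realType) (n : nat) (eta : nat -> R[i])
    (I : Type) (z : I -> R[i]) :
    (1 < n)%N -> eta 0%N = 1 -> (forall j, (0 < j)%N -> `|eta j| < 1) ->
  symmetrical n z -> ~ rearrangement (nonzero_terms eta) z.
Proof.
move=> n_gt1 eta0 eta_lt1 zsym [s [[s' s'K sK] sE]].
have nz0 : eta 0%N != 0 by rewrite eta0 oner_eq0.
have [t [_ tE]] := zsym 1%N n_gt1.
pose i := t (s (exist _ 0%N nz0)).
have := tE (s (exist _ 0%N nz0)); rewrite -sE /nonzero_terms /= eta0 expr1.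
rewrite -/i -(sK i) -sE /nonzero_terms; case: (s' i) => -[|j] nzj /=.
  rewrite eta0 mul1r => /esym/eqP; rewrite -[omega R n]expr1.
  by rewrite -(prim_order_dvd (omega_primitive R n (ltnW n_gt1))) dvdn1 gtn_eqF.
move=> /(congr1 Num.norm); rewrite normrM norm_omega normr1 mulr1 => /esym/eqP.
by rewrite lt_eqF // eta_lt1.
Qed.

Theorem corollary5p4 (R : realType) (n : nat) (hn : (2 <= n)%N) :
  exists eta : nat -> R[i],
    (forall m : nat, (1 <= m)%N -> ~~ (n %| m)%N -> power_sum_eq m eta 0) /\
    ~ ((exists z : nat -> R[i],
          symmetrical n z /\ rearrangement (nonzero_terms eta) z) \/
       (exists (N : nat) (z : 'I_N -> R[i]),
          symmetrical n z /\ rearrangement (nonzero_terms eta) z)).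
Proof.
have [eta [eta0 eta_lt1 eta_sum]] := exists_vanishing_power_sums R.
exists eta; split=> [m m_gt0 _|]; first exact: eta_sum.
by case=> [[z [zsym]]|[N [z [zsym]]]]; apply: not_symmetrical_rearrangement zsym.
Qed.
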